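(* Let $p$ be a prime and let $G$ be a $p$-group of nilpotency class $2$. Let $(g_i)_{i\in J}$ be elements of $G$ ($J$ totally ordered) such that $B_G=\{g_iZ(G): i\in J\}$ generates $G/Z(G)$. Let $g\in G'$ be such that for each choice of integers $\{d_{i,j}: i<j\}$ (all but finitely many zero) with $g=\prod_{i<j}[g_i,g_j]^{d_{i,j}}$, the associated weighted graph $\Gamma(D)$ contains a bad cycle with unfavorable proximity. Then $g$ is not a commutator in $G$, i.e. there are no $x,y\in G$ with $g=[x,y]$.
   Context: A $p$-group is a (finite or infinite) group in which every element has $p$-power order. $Z(G)$ is the center, $G'$ the derived subgroup, $[x,y]=xyx^{-1}y^{-1}$. The graph $\Gamma(D)$ of an expression $g=\prod_{i<j}[g_i,g_j]^{d_{i,j}}$: let $\mathcal{I}$ be the finite set of all indices that occur (as first or second index) in some pair with nonzero exponent. The function $D$ on pairs $i<j$ in $\mathcal{I}$ (a ''presentation'' of $g$) takes the value $D(i,j)=\varepsilon$ (a formal symbol) if $[g_i,g_j]=1$, and $D(i,j)=d_{i,j}\in\mathbb{Z}\subset\mathbb{Z}_p$ (the $p$-adic integers) if $[g_i,g_j]\neq1$. The weighted graph $\Gamma(D)$ has vertices $v_i$, $i\in\mathcal{I}$, and for $i<j$ in $\mathcal{I}$ with $D(i,j)\neq\varepsilon$ it has an edge between $v_i$ and $v_j$ with weight $d_{i,j}$ (the weight may be $0$). Isolated vertices are discarded. Bad cycle: a simple cycle $u_1\to u_2\to\cdots\to u_r\to u_1$ in a finite simple graph $\Gamma$ is bad if $\deg_\Gamma(u_i)>2$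 for all $i\le r-2$ and $\deg_\Gamma(u_{r-1})=\deg_\Gamma(u_r)=2$. Proximity: given such a bad cycle $C_r$ (with $\deg_\Gamma(u_i)>2$ for $i\le r-2$ and $\deg_\Gamma(u_{r-1})=\deg_\Gamma(u_r)=2$) and, for each $1\le i\le r-2$, a vertex $u_{r+i}$ adjacent to $u_i$ and lying outside $C_r$, the subgraph consisting of $C_r$, the vertices $u_{r+i}$ and the edges between $u_i$ and $u_{r+i}$ is a proximity for $C_r$. It is unfavorable if the weights of the edges $u_1u_2,\,u_2u_3,\dots,u_{r-2}u_{r-1}$ and $u_1u_r$ are all divisible by $p$, while the weights of the edges $u_{r-1}u_r,\ u_1u_{r+1},\ u_2u_{r+2},\dots,u_{r-2}u_{2r-2}$ are all not divisible by $p$. *)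

(* Defs.v *)
From HB Require Import structures.
From mathcomp Require Import all_boot all_order all_algebra.
From mathcomp Require Import finmap boolp classical_sets.

Set Implicit Arguments.
Unset Strict Implicit.
Unset Printing Implicit Defensive.

Import Order.TTheory.

Local Open Scope classical_set_scope.
Local Open Scope fset_scope.
Local Open Scope group_scope.

Section Groups.
Variable G : groupType.
Implicit Types (A B H : set G) (x y z : G).

Definition is_p_group (p : nat) : Prop := forall x, exists k, x ^+ (p ^ k)%N = 1.

Definition expgz x (m : int) : G :=
  match m with Posz n => x ^+ n | Negz n => x ^- n.+1 end.

(* The convention x y x^-1 y^-1 differs from that of [~ x, y], which denotes
   x^-1 y^-1 x y. *)
Definition comm x y : G := x * y * x^-1 * y^-1.

Definition center : set G := [set z | forall x, z * x = x * z].

Definition is_subgroup H : Prop :=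
  [/\ H 1, forall x y, H x -> H y -> H (x * y) & forall x, H x -> H x^-1].

Definition generated A : set G := smallest is_subgroup A.

Definition comm_subgroup A B : set G :=
  generated [set comm x y | x in A & y in B].

Definition derived_subgroup : set G := comm_subgroup setT setT.

(* Indexed from 0: lower_central n is gamma_(n+1)(G). *)
Fixpoint lower_central (n : nat) : set G :=
  if n is m.+1 then comm_subgroup (lower_central m) setT else setT.

Definition has_nilpotency_class (c : nat) : Prop :=
  lower_central c = [set 1] /\
  forall k, (k < c)%N -> lower_central k <> [set 1].

End Groups.

Arguments is_p_group : clear implicits.
Arguments center : clear implicits.
Arguments derived_subgroup : clear implicits.
Arguments lower_central : clear implicits.
Arguments has_nilpotency_class : clear implicits.

(* The quotient group G / Z(G), as a groupType on the classes xZ(G). *)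
Section CenterQuotient.
Variable G : groupType.
Implicit Types x y z : G.
Local Open Scope quotient_scope.

Definition center_rel : rel G := fun x y => `[< center G (x^-1 * y) >].

Lemma center_relP x y :
  reflect (exists2 z, center G z & y = x * z) (center_rel x y).
Proof.
apply: (iffP idP) => [/asboolP Zxy|[z Zz ->]].
  by exists (x^-1 * y); rewrite // mulVKg.
by apply/asboolP; rewrite mulKg.
Qed.

Lemma center1 : center G 1.
Proof. by move=> x; rewrite mul1g mulg1. Qed.

Lemma centerM z t : center G z -> center G t -> center G (z * t).
Proof. by move=> Zz Zt x; rewrite -mulgA Zt !mulgA Zz. Qed.

Lemma centerV z : center G z -> center G z^-1.
Proof. by move=> Zz x; apply: (mulgI z); rewrite mulVKg mulgA Zz mulgK. Qed.

Lemma center_rel_equiv : equiv_class_of center_rel.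
Proof.
have sym x y : center_rel x y -> center_rel y x.
  case/center_relP=> z Zz ->; apply/center_relP.
  by exists z^-1; [exact: centerV | rewrite mulgK].
split=> [x | x y | y x t].
- by apply/center_relP; exists 1; [exact: center1 | rewrite mulg1].
- by apply/idP/idP; apply: sym.
- case/center_relP=> z Zz -> /center_relP[w Zw ->]; apply/center_relP.
  by exists (z * w); [exact: centerM | rewrite mulgA].
Qed.

Canonical center_equiv : equiv_rel G :=
  EquivRelPack center_rel_equiv.

Definition center_quotient := {eq_quot center_equiv}.
HB.instance Definition _ := Choice.on center_quotient.

Definition cq_pi (x : G) : center_quotient := \pi x.
Definition cq_one : center_quotient := cq_pi 1.
Definition cq_mul (a b : center_quotient) : center_quotient :=
  cq_pi (repr a * repr b).
Definition cq_inv (a : center_quotient) : center_quotient := cq_pi (repr a)^-1.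

Lemma cq_piP x y : cq_pi x = cq_pi y <-> exists2 z, center G z & y = x * z.
Proof.
by split=> [/eqmodP/center_relP // | Zxy]; apply/eqmodP/center_relP.
Qed.

Lemma repr_cq_pi x : exists2 z, center G z & repr (cq_pi x) = x * z.
Proof. by apply/cq_piP; rewrite /cq_pi reprK. Qed.

Lemma cq_piM x y : cq_pi (x * y) = cq_mul (cq_pi x) (cq_pi y).
Proof.
have [z Zz Ez] := repr_cq_pi x; have [w Zw Ew] := repr_cq_pi y.
apply/cq_piP; exists (z * w); first exact: centerM.
by rewrite Ez Ew -!mulgA; congr (_ * _); rewrite !mulgA Zz.
Qed.

Lemma cq_piV x : cq_pi x^-1 = cq_inv (cq_pi x).
Proof.
have [z Zz Ez] := repr_cq_pi x; apply/cq_piP; exists z^-1; first exact: centerV.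
by rewrite Ez invgM (centerV Zz).
Qed.

Lemma cq_piK (a : center_quotient) : cq_pi (repr a) = a.
Proof. exact: reprK. Qed.

Lemma cq_mulA : associative cq_mul.
Proof.
move=> a b c; rewrite -(cq_piK a) -(cq_piK b) -(cq_piK c).
by rewrite -!cq_piM mulgA.
Qed.

Lemma cq_mul1 : left_id cq_one cq_mul.
Proof. by move=> a; rewrite -(cq_piK a) -cq_piM mul1g. Qed.

Lemma cq_mulr1 : right_id cq_one cq_mul.
Proof. by move=> a; rewrite -(cq_piK a) -cq_piM mulg1. Qed.

Lemma cq_mulV : left_inverse cq_one cq_inv cq_mul.
Proof. by move=> a; rewrite -(cq_piK a) -cq_piV -cq_piM mulVg. Qed.

Lemma cq_mulrV : right_inverse cq_one cq_inv cq_mul.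
Proof. by move=> a; rewrite -(cq_piK a) -cq_piV -cq_piM mulgV. Qed.

HB.instance Definition _ := isGroup.Build center_quotient
  cq_mulA cq_mul1 cq_mulr1 cq_mulV cq_mulrV.

End CenterQuotient.

Section WeightedGraphs.
Variable V : choiceType.

(* edge u v is Some w for an edge of weight w between u and v (w may be 0), and
   None when there is no such edge. *)
Record wgraph := WGraph {
  vertices : {fset V};
  edge : V -> V -> option int;
  edge_sym : forall u v, edge u v = edge v u;
  edge_irr : forall u, edge u u = None;
  edge_vertices : forall u v, edge u v != None -> u \in vertices }.

Variable Gam : wgraph.
Implicit Types (p r i : nat) (u : nat -> V).

Definition adj : rel V := fun v w => edge Gam v w != None.

Definition deg (v : V) : nat := #|` [fset w in vertices Gam | adj v w] |.

(* Only meaningful on adjacent vertices. *)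
Definition weight (v w : V) : int := odflt 0%R (edge Gam v w).

(* The cycle is u 1, ..., u r; the other values of u are irrelevant here. *)
Definition bad_cycle r u : Prop :=
  [/\ (2 < r)%N,
      ucycle adj [seq u i | i <- iota 1 r],
      forall i, (1 <= i <= r - 2)%N -> (2 < deg (u i))%N,
      deg (u (r - 1)%N) = 2%N
    & deg (u r) = 2%N].

(* The r - 2 vertices u (r + 1), ..., u (2r - 2) need not be distinct. *)
Definition proximity r u : Prop :=
  forall i, (1 <= i <= r - 2)%N ->
    adj (u i) (u (r + i)%N) /\ u (r + i)%N \notin [seq u j | j <- iota 1 r].

Definition unfavorable p r u : Prop :=
  [/\ forall i, (1 <= i <= r - 2)%N -> (p %| weight (u i) (u i.+1))%Z,
      (p %| weight (u 1%N) (u r))%Z,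
      ~~ (p %| weight (u (r - 1)%N) (u r))%Z
    & forall i, (1 <= i <= r - 2)%N -> ~~ (p %| weight (u i) (u (r + i)%N))%Z].

Definition has_bad_cycle_with_unfavorable_proximity p : Prop :=
  exists r u, [/\ bad_cycle r u, proximity r u & unfavorable p r u].

End WeightedGraphs.

Section Presentations.
Variables (disp : Order.disp_t) (J : orderType disp).

(* Integers d (i, j), i < j, all but finitely many zero. *)
Definition exponents := {fsfun J * J -> int with 0%R}.

Definition on_increasing_pairs (d : exponents) : Prop :=
  forall i j, (i, j) \in finsupp d -> (i < j)%O.

Definition indices (d : exponents) : {fset J} :=
  [fset ij.1 | ij in finsupp d] `|` [fset ij.2 | ij in finsupp d].

Variables (G : groupType) (g_ : J -> G).

(* When G has nilpotency class 2 the commutators are central, so the order of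
   the factors is immaterial. *)
Definition commutator_product (d : exponents) : G :=
  \prod_(ij <- finsupp d) expgz (comm (g_ ij.1) (g_ ij.2)) (d ij).

(* None stands for the formal symbol epsilon. *)
Definition presentation (d : exponents) (i j : J) : option int :=
  if comm (g_ i) (g_ j) == 1 then None else Some (d (i, j)).

Section Graph.
Variables (I : {fset J}) (D : J -> J -> option int).

Definition graph_edge (i j : J) : option int :=
  if (i \in I) && (j \in I) then
    if (i < j)%O then D i j else if (j < i)%O then D j i else None
  else None.

(* The isolated vertices of I are discarded. *)
Definition graph_vertices : {fset J} :=
  [fset i in I | has (fun j => graph_edge i j != None) I].

Lemma graph_edge_sym i j : graph_edge i j = graph_edge j i.
Proof. by rewrite /graph_edge andbC; case: ltgtP. Qed.

Lemma graph_edge_irr i : graph_edge i i = None.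
Proof. by rewrite /graph_edge ltxx if_same. Qed.

Lemma graph_edge_vertices i j : graph_edge i j != None -> i \in graph_vertices.
Proof.
move=> Eij; have: (i \in I) && (j \in I) by move: Eij; rewrite /graph_edge; case: ifP.
by case/andP=> Ii Ij; rewrite !inE /= Ii; apply/hasP; exists j.
Qed.

Definition graph : wgraph J :=
  WGraph graph_edge_sym graph_edge_irr graph_edge_vertices.

End Graph.

Definition Gamma (d : exponents) : wgraph J :=
  graph (indices d) (presentation d).

End Presentations.

(* Main.v *)
From HB Require Import structures.
Require Import Defs.
From mathcomp Require Import all_boot all_order all_algebra.
From mathcomp Require Import finmap boolp classical_sets.
From mathcomp Require Import zify ring.

Set Implicit Arguments.
Unset Strict Implicit.
Unset Printing Implicit Defensive.

Import Order.TTheory GRing.Theory.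
Local Open Scope fset_scope.
Local Open Scope ring_scope.

(**
The point is that the commutators [x, y] have presentations of a very special
shape.  In nilpotency class 2 the commutator is an alternating bilinear form
with values in the center, which factors through G / Z(G).  Writing x and y
modulo the center as products of powers g_i ^ a_i and g_i ^ b_i thus gives
  [x, y] = prod_(i < j) [g_i, g_j] ^ (a_i b_j - a_j b_i),
a presentation whose exponents are the 2 x 2 minors of a matrix with rows a
and b (comm_minors).  Every edge of its graph, including those of weight 0, is
weighted by the corresponding minor up to sign.

Such a graph has no bad cycle with unfavorable proximity (minors_favorable).
Let v_i be the vector (a_i, b_i) modulo p.  The proximity edges have weight
prime to p, so the vectors at u_1, ..., u_(r-2) are nonzero.  The edges from
u_r to u_1 and from u_i to u_(i+1), i <= r-2, have weight divisible by p, so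
each joins two parallel vectors.  Parallelism passes through nonzero vectors
(minor_trans), so walking along u_r, u_1, ..., u_(r-1) shows that the vectors at
u_r and u_(r-1) are parallel, whereas the weight of the edge between them is
prime to p.  Hence if g were [x, y], the presentation by minors would contradict
the hypothesis on g.
*)

(** * Finitely supported integral combinations *)

Section Lincomb.
Variables (K : choiceType) (V : zmodType).
Implicit Types (a b : {fsfun K -> int with 0}) (F : K -> V).

Definition lincomb a F : V := \sum_(i <- finsupp a) F i *~ a i.

(** The sum may be taken over any larger finite set, so that combinations with
    different supports can be compared over a common one. *)
Lemma lincombE (S : {fset K}) a F :
  (finsupp a `<=` S)%fset -> lincomb a F = \sum_(i <- S) F i *~ a i.
Proof.
move=> sub; apply: big_fset_incl => // i _ ai.
by rewrite (fsfun_dflt ai) mulr0z.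
Qed.

Lemma lincomb0 F : lincomb [fsfun] F = 0.
Proof. by rewrite /lincomb finsupp0 big_seq_fset0. Qed.

Lemma lincomb1 k F : lincomb [fsfun i in [fset k] => 1] F = F k.
Proof.
rewrite (@lincombE [fset k]%fset) ?finsupp_sub //.
by rewrite big_seq_fset1 fsfunE inE eqxx mulr1z.
Qed.

Lemma lincombD a b :
  exists c, forall F, lincomb c F = lincomb a F + lincomb b F.
Proof.
pose S := (finsupp a `|` finsupp b)%fset.
exists [fsfun i in S => a i + b i] => F.
rewrite (@lincombE S) ?finsupp_sub // (@lincombE S a) ?fsubsetUl //.
rewrite (@lincombE S b) ?fsubsetUr // -big_split /=.
by rewrite !big_seq; apply: eq_bigr => i Si; rewrite fsfunE Si mulrzDr.
Qed.

Lemma lincombN a : exists c, forall F, lincomb c F = - lincomb a F.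
Proof.
exists [fsfun i in finsupp a => - a i] => F.
rewrite (@lincombE (finsupp a)) ?finsupp_sub // /lincomb -sumrN !big_seq.
by apply: eq_bigr => i Si; rewrite fsfunE Si mulrNz.
Qed.

End Lincomb.

(** * Exponents given by minors *)

Section Det.
Variables (disp : Order.disp_t) (J : orderType disp).
Implicit Types (a b : {fsfun J -> int with 0}).

Definition minor (a b : J -> int) (i j : J) : int := a i * b j - a j * b i.

Lemma minorC a b i j : minor a b j i = - minor a b i j.
Proof. by rewrite /minor; ring. Qed.

(** Modulo a prime, parallelism of vectors in the plane passes through any
    nonzero vector; the minor with t witnesses that the vector at j is nonzero.
    The proof is the Pluecker relation, which turns the claim into Euclid's
    lemma. *)
Lemma minor_trans (a b : J -> int) p i j k t : prime p ->
    (p %| minor a b i j)%Z -> (p %| minor a b j k)%Z ->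
  ~~ (p %| minor a b j t)%Z -> (p %| minor a b i k)%Z.
Proof.
move=> pp pij pjk; apply: contraR => pik.
have E : minor a b i k * minor a b j t =
  minor a b i j * minor a b k t + minor a b i t * minor a b j k.
  by rewrite /minor; ring.
have : (p %| minor a b i k * minor a b j t)%Z.
  by rewrite E; apply: rpredD; [apply: dvdz_mulr | apply: dvdz_mull].
rewrite !dvdzE abszM /= Euclid_dvdM //.
by rewrite dvdzE /= in pik; rewrite (negPf pik).
Qed.

(** The exponents that bilinearity assigns to a commutator of two elements with
    exponent vectors a and b. *)
Definition minors a b : exponents J :=
  let S := (finsupp a `|` finsupp b)%fset in
  [fsfun ij in (S `*` S)%fset =>
     if (ij.1 < ij.2)%O then minor a b ij.1 ij.2 else 0].

Lemma minorsE a b i j : (i < j)%O -> minors a b (i, j) = minor a b i j.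
Proof.
move=> ltij; rewrite fsfunE in_fsetM /= ltij; case: ifP => // /negbT.
rewrite negb_and !in_fsetU !negb_or /minor.
by case/orP=> /andP[aN bN]; rewrite (fsfun_dflt aN) (fsfun_dflt bN); ring.
Qed.

Lemma minors_increasing a b : on_increasing_pairs (minors a b).
Proof.
move=> i j; rewrite mem_finsupp fsfunE; case: ifP => //= _.
by case: ifP.
Qed.

(** Terms on the diagonal vanish and the terms at (i, j) and (j, i) combine
    into one, with coefficient a_i b_j - a_j b_i. *)
Lemma lincomb_minors (V : zmodType) (F : J -> J -> V) a b :
    (forall i, F i i = 0) -> (forall i j, F j i = - F i j) ->
  lincomb a (fun i => lincomb b (F i)) =
  lincomb (minors a b) (fun ij => F ij.1 ij.2).
Proof.
move=> F0 FN; set S := (finsupp a `|` finsupp b)%fset.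
pose T i j := F i j *~ (a i * b j).
have -> : lincomb a (fun i => lincomb b (F i))
  = \sum_(i <- S) \sum_(j <- S) T i j.
  rewrite (@lincombE _ _ S) ?fsubsetUl //; apply: eq_bigr => i _.
  rewrite (@lincombE _ _ S) ?fsubsetUr // mulrz_suml.
  by apply: eq_bigr => j _; rewrite -mulrzA mulrC.
have -> : lincomb (minors a b) (fun ij => F ij.1 ij.2) =
  \sum_(i <- S) \sum_(j <- S) (if (i < j)%O then T i j + T j i else 0).
  rewrite (@lincombE _ _ (S `*` S)%fset) ?finsupp_sub //.
  rewrite big_imfset2 /=; last by move=> [? ?] [? ?] _ _ /= [-> ->].
  rewrite !big_seq; apply: eq_bigr => i Si; rewrite !big_seq.
  apply: eq_bigr => j Sj; rewrite fsfunE in_fsetM Si Sj /=; case: ifP => // _.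
  by rewrite /T (FN i j) mulNrz -mulrzBr.
have T_split i j : T i j = (if (i < j)%O then T i j else 0)
                        + (if (j < i)%O then T i j else 0).
  case: ltgtP => [_|_|->]; rewrite ?addr0 ?add0r //.
  by rewrite /T F0 mul0rz.
under eq_bigr do (under eq_bigr do rewrite T_split; rewrite big_split /=).
rewrite big_split /= [X in _ + X]exchange_big /= -big_split /=.
apply: eq_bigr => i _; rewrite -big_split /=; apply: eq_bigr => j _.
by case: ifP; rewrite ?addr0.
Qed.

End Det.

(** * Bad cycles *)

Section BadCycle.
Variable V : choiceType.

(** Nonadjacent vertices have the default weight 0, which p divides. *)
Lemma adj_dvdzN p (Gam : wgraph V) (v w : V) :
  ~~ (p %| weight Gam v w)%Z -> adj Gam v w.
Proof. by rewrite /weight /adj; case: (edge Gam v w) => //=; rewrite dvdz0. Qed.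

Lemma bad_cycle_adj (Gam : wgraph V) r u : bad_cycle Gam r u ->
  adj Gam (u r) (u 1%N) /\ forall i, (1 <= i < r)%N -> adj Gam (u i) (u i.+1).
Proof.
case=> r2 /andP[cyc _] _ _ _; case: r r2 cyc => // r r2.
rewrite /= rcons_path path_map last_map => /andP[path_u last_u]; split.
  suff E : last 1%N (iota 2 r) = r.+1 by rewrite /= E in last_u.
  by rewrite (last_nth 0%N) size_iota (nth_iota 0%N 1%N (n := r.+1)).
move=> [|i] // /andP[_ lt_ir]; move/(pathP 0%N): path_u => /(_ i).
rewrite size_iota => /(_ lt_ir) /=.
by rewrite (nth_iota 0%N 1%N (n := r.+1)) 1?ltnW // nth_iota.
Qed.

End BadCycle.

(** * The center as an additive group *)

Section Central.
Variable G : groupType.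
Local Open Scope group_scope.

(** The center is rebuilt as a type so that it can carry an additive structure:
    sums of central elements may then be reordered and exchanged freely. *)
Definition central := {z : G | `[< center G z >]}.
HB.instance Definition _ := Choice.on central.
Implicit Types z t : central.

Lemma centralP z : center G (val z).
Proof. exact/asboolP/(valP z). Qed.

Definition in_center (x : G) (Zx : center G x) : central :=
  exist _ x (asboolT Zx).

Definition central_mul z t : central :=
  in_center (centerM (centralP z) (centralP t)).
Definition central_inv z : central := in_center (centerV (centralP z)).
Definition central_one : central := in_center (@center1 G).

Fact central_mulA : associative central_mul.
Proof. by move=> x y z; apply: val_inj; rewrite /= mulgA. Qed.
Fact central_mulC : commutative central_mul.
Proof. by move=> x y; apply: val_inj; rewrite /= (centralP x). Qed.
Fact central_mul1 : left_id central_one central_mul.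
Proof. by move=> x; apply: val_inj; rewrite /= mul1g. Qed.
Fact central_mulV : left_inverse central_one central_inv central_mul.
Proof. by move=> x; apply: val_inj; rewrite /= mulVg. Qed.

HB.instance Definition _ := GRing.isZmodule.Build central
  central_mulA central_mulC central_mul1 central_mulV.

Lemma val_centralMz z (m : int) : val (z *~ m)%R = expgz (val z) m.
Proof.
have vn n : val (z *+ n)%R = val z ^+ n.
  by elim: n => // n IH; rewrite mulrS expgS -IH.
by case: m => n /=; rewrite -vn // NegzE.
Qed.

Lemma val_central_sum (I : Type) (r : seq I) (F : I -> central) :
  val (\sum_(i <- r) F i)%R = \prod_(i <- r) val (F i).
Proof. by apply: (big_morph val). Qed.

End Central.

(** * The commutator form in nilpotency class 2 *)

Section ClassTwo.
Variable G : groupType.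
Hypothesis cl2 : has_nilpotency_class G 2.
Local Open Scope group_scope.
Implicit Types x y z : G.

Lemma mulg_comm x y : x * y = comm x y * (y * x).
Proof. by rewrite /comm !mulgA !mulgVK. Qed.

Lemma comm1P x y : reflect (x * y = y * x) (comm x y == 1).
Proof.
by rewrite -(inj_eq (mulIg (y * x))) -mulg_comm mul1g; apply: eqP.
Qed.

Lemma comm_center x y : center G (comm x y).
Proof.
case: cl2 => /= l2 _ z; apply/comm1P/eqP.
suff: [set 1]%classic (comm (comm x y) z) by [].
rewrite -l2; apply: sub_gen_smallest; exists (comm x y); last by exists z.
by apply: sub_gen_smallest; exists x => //; exists y.
Qed.

Definition comm_form x y : central G := in_center (comm_center x y).

(** Since xx'y = x[x',y]yx' = [x',y][x,y]yxx', the factor [x',y] being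
    central. *)
Lemma comm_formD x x' y :
  comm_form (x * x') y = (comm_form x y + comm_form x' y)%R.
Proof.
apply: val_inj => /=; apply: (mulIg (y * (x * x'))).
rewrite -mulg_comm -[LHS]mulgA (mulg_comm x' y) [LHS]mulgA.
rewrite -(comm_center x' y x) -[LHS]mulgA (mulgA x) (mulg_comm x y).
by rewrite (comm_center x y (comm x' y)) !mulgA.
Qed.

Lemma comm_formxx x : comm_form x x = 0%R.
Proof. by apply: val_inj; rewrite /= /comm mulgK mulgV. Qed.

Lemma comm_formC x y : comm_form y x = (- comm_form x y)%R.
Proof.
by apply: val_inj; rewrite /= /comm !invgM !invgK !mulgA.
Qed.

Lemma comm_form_center z y : center G z -> comm_form z y = 0%R.
Proof. by move=> Zz; apply: val_inj; apply/eqP/comm1P. Qed.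

Lemma comm_form1 y : comm_form 1 y = 0%R.
Proof. exact/comm_form_center/center1. Qed.

Lemma comm_formV x y : comm_form x^-1 y = (- comm_form x y)%R.
Proof. by apply/eqP; rewrite -addr_eq0 -comm_formD mulVg comm_form1. Qed.

Lemma comm_form_cq_pi x x' y :
  cq_pi x = cq_pi x' -> comm_form x y = comm_form x' y.
Proof.
by case/cq_piP => z Zz ->; rewrite comm_formD (comm_form_center y Zz) addr0.
Qed.

End ClassTwo.

(** * Coordinates of commutators *)

Section Coordinates.
Variables (G : groupType) (disp : Order.disp_t).
Variables (J : orderType disp) (g_ : J -> G).
Hypothesis cl2 : has_nilpotency_class G 2.
Hypothesis genG :
  generated (range (fun i => cq_pi (g_ i))) = [set: center_quotient G]%classic.

(** This says that x is the product of the g_i ^ a_i modulo the radical of the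
    form, which is the center. Recording x through its pairings avoids ordered
    products of the noncommuting g_i. *)
Definition coordinates (x : G) (a : {fsfun J -> int with 0}) : Prop :=
  forall y, comm_form cl2 x y = lincomb a (fun i => comm_form cl2 (g_ i) y).

(** The classes of the elements that have coordinates form a subgroup of the
    quotient by the center, and it contains the given generators. *)
Lemma coordinates_exist x : exists a, coordinates x a.
Proof.
pose H := [set q : center_quotient G | exists a, coordinates (repr q) a]%classic.
have HP z : H (cq_pi z) <-> exists a, coordinates z a.
  by split=> -[a Ca]; exists a => y; rewrite -Ca; apply: comm_form_cq_pi;
    rewrite cq_piK.
suff /(_ (cq_pi x) I)/HP : ([set: center_quotient G] `<=` H)%classic by [].
rewrite -genG; apply: smallest_sub.
  split=> [|q q'|q].
  - by apply/HP; exists [fsfun] => y; rewrite lincomb0 comm_form1.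
  - rewrite -(cq_piK q) -(cq_piK q') => /HP[a Ca] /HP[b Cb].
    have [c Ec] := lincombD (central G) a b.
    (* The group law of the quotient is cq_mul, which cq_pi respects. *)
    change (H (cq_mul (cq_pi (repr q)) (cq_pi (repr q')))).
    by rewrite -cq_piM; apply/HP; exists c => y; rewrite Ec comm_formD Ca Cb.
  - rewrite -(cq_piK q) => /HP[a Ca]; have [c Ec] := lincombN (central G) a.
    change (H (cq_inv (cq_pi (repr q)))).
    by rewrite -cq_piV; apply/HP; exists c => y; rewrite Ec comm_formV Ca.
move=> _ [k _ <-]; apply/HP; exists [fsfun i in [fset k] => 1] => y.
by rewrite lincomb1.
Qed.

Lemma comm_minors x y a b : coordinates x a -> coordinates y b ->
  comm x y = commutator_product g_ (minors a b).
Proof.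
move=> Ca Cb.
suff: comm_form cl2 x y =
  lincomb (minors a b) (fun ij => comm_form cl2 (g_ ij.1) (g_ ij.2)).
  move/(congr1 val) => /= ->; rewrite val_central_sum.
  by apply: eq_bigr => ij _; rewrite val_centralMz.
rewrite Ca -(@lincomb_minors _ _ _ (fun i j => comm_form cl2 (g_ i) (g_ j))).
- apply: eq_bigr => i _; congr (_ *~ _).
  rewrite comm_formC Cb /lincomb -sumrN; apply: eq_bigr => j _.
  by rewrite comm_formC mulNrz opprK.
- by move=> i; apply: comm_formxx.
- by move=> i j; apply: comm_formC.
Qed.

(** The weight is the minor itself only for i < j; the sign lost otherwise does
    not affect divisibility. *)
Lemma dvdz_weight_minor p a b i j :
    adj (Gamma g_ (minors a b)) i j ->
  (p %| weight (Gamma g_ (minors a b)) i j)%Z = (p %| minor a b i j)%Z.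
Proof.
rewrite /adj /weight /= /graph_edge; case: ifP => // _.
case: ltgtP => // lt_ij; rewrite /presentation; case: ifP => //= _ _.
  by rewrite minorsE.
by rewrite minorsE // minorC rpredN.
Qed.

Lemma minors_favorable p a b : prime p ->
  ~ has_bad_cycle_with_unfavorable_proximity (Gamma g_ (minors a b)) p.
Proof.
move=> pp [r] [u] [bad prox [dvd_path dvd_1r ndvd_last ndvd_prox]].
have [adj_r1 adj_path] := bad_cycle_adj bad.
have r2 : (2 < r)%N by case: bad.
(* The vector at u_r is parallel to all those at u_1, ..., u_(r-1). *)
have par i : (1 <= i < r)%N -> (p %| minor a b (u r) (u i))%Z.
  elim: i => // -[_ _|i IH lt_ir].
    rewrite minorC rpredN -dvdz_weight_minor //.
    by rewrite /adj edge_sym.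
  have le_ir : (1 <= i.+1 <= r - 2)%N by lia.
  (* The proximity edge at u_(i+1) witnesses that the vector there is nonzero. *)
  apply: (minor_trans (j := u i.+1) (t := u (r + i.+1)%N)) => //.
  - by apply: IH; lia.
  - rewrite -dvdz_weight_minor ?dvd_path // adj_path //; lia.
  - have := ndvd_prox _ le_ir.
    by move=> N; rewrite -dvdz_weight_minor ?(adj_dvdzN N).
case/negP: (ndvd_last).
rewrite dvdz_weight_minor ?(adj_dvdzN ndvd_last) // minorC rpredN.
by apply: par; lia.
Qed.

End Coordinates.

Theorem theorem1p2 (p : nat) (G : groupType) (disp : Order.disp_t)
    (J : orderType disp) (g_ : J -> G) (g : G) :
  prime p ->
  is_p_group G p ->
  has_nilpotency_class G 2 ->
  generated (range (fun i => cq_pi (g_ i))) = [set: center_quotient G]%classic ->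
  derived_subgroup G g ->
  (forall d : exponents J,
     on_increasing_pairs d -> g = commutator_product g_ d ->
     has_bad_cycle_with_unfavorable_proximity (Gamma g_ d) p) ->
  ~ exists x y : G, g = comm x y.
Proof.
move=> p_prime _ cl2 genG _ bad [x [y g_xy]].
have [a Ca] := coordinates_exist cl2 genG x.
have [b Cb] := coordinates_exist cl2 genG y.
apply: (minors_favorable p_prime (bad (minors a b) _ _)).
  exact: minors_increasing.
by rewrite g_xy (comm_minors Ca Cb).
Qed.
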